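(* Let $\mathbb{D}$ be a distributive category. The Kleisli category $\mathbb{D}_{\cdot+\top}$ of its exception monad is an isomix symmetric linearly distributive category, with tensor structure $(\mathbb{D}_{\cdot+\top},\curlyvee,\bot)$ and par structure $(\mathbb{D}_{\cdot+\top},+,\bot)$, where the left linear distributor is the Kleisli map $\delta^L_{A,B,C}: A\curlyvee(B+C)\to (A\curlyvee B)+C$ whose underlying map in $\mathbb{D}$, $$[\![\delta^L_{A,B,C}]\!]:(A+(B+C))+(A\times(B+C))\to\big(((A+B)+(A\times B))+C\big)+\top,$$ is the unique map induced by the following maps of $\mathbb{D}$ on the summands $A$, $B$, $C$, $A\times(B+C)$: (a) $\iota^0_{A,B};\iota^0_{A+B,A\times B};\iota^0_{A\curlyvee B,C};\iota^0_{(A\curlyvee B)+C,\top}$ on $A$; (b) $\iota^1_{A,B};\iota^0_{A+B,A\times B};\iota^0_{A\curlyvee B,C};\iota^0_{(A\curlyvee B)+C,\top}$ on $B$; (c) $\iota^1_{A\curlyvee B,C};\iota^0_{(A\curlyvee B)+C,\top}$ on $C$; (d) $(d^L_{A,B,C})^{-1};(1_{A\times B}+t_{A\times C});(\iota^1_{A+B,A\times B}+1_\top);(\iota^0_{A\curlyvee B,C}+1_\top)$ on $A\times(B+C)$, passing through $(A\times B)+(A\times C)$ and $(A\times B)+\top$.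
   Context: Composition is in diagrammatic order ($f;g$: first $f$, then $g$). A distributive category $\mathbb{D}$ is a category with finite products ($\times$, $\top$, $\pi^i$, $t_A:A\to\top$) and finite coproducts ($+$, $\bot$, $\iota^i$, $b_A:\bot\to A$) such that the canonical maps $d^L_{A,B,C}=[1_A\times\iota^0_{B,C},1_A\times\iota^1_{B,C}]:(A\times B)+(A\times C)\to A\times(B+C)$ (equivalently $d^R_{A,B,C}:(A\times C)+(B\times C)\to(A+B)\times C$) are isomorphisms. Exception monad: the functor $\cdot+\top$ on $\mathbb{D}$ with unit $\eta_A=\iota^0_{A,\top}$ and multiplication $\mu_A=[1_{A+\top},\iota^1_{A,\top}]$. A map $f:A\to B$ of its Kleisli category $\mathbb{D}_{\cdot+\top}$ is a map $[\![f]\!]:A\to B+\top$ of $\mathbb{D}$; $[\![1_A]\!]=\eta_A$, $[\![f;g]\!]=[\![f]\!];([\![g]\!]+1_\top);\mu$. Let $J:\mathbb{D}\to\mathbb{D}_{\cdot+\top}$, $[\![J(f)]\!]=f;\eta$. The category $\mathbb{D}_{\cdot+\top}$ has finite coproducts given on objects as in $\mathbb{D}$ (with injections $J(\iota^i)$), and $\bot$ is a zero object of it. For Kleisli maps $f:A\to A'$, $g:B\to B'$, the Kleisli map $f\times g:A\times B\to A'\times B'$ has underlying map $[\![f]\!]\times[\![g]\!]$ followed by the map $(A'+\top)\times(B'+\top)\to(A'\times B')+\top$ which, under the distributivity isomorphism $(A'+\top)\times(B'+\top)\cong (A'\times B')+\big((A'\times\top)+(\top\times(B'+\top))\big)$,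 is $1_{A'\times B'}+t$. This makes $(\mathbb{D}_{\cdot+\top},\times,\top)$ symmetric monoidal with structure isomorphisms the $J$-images of those of $\mathbb{D}$. The functor $\curlyvee$ on $\mathbb{D}_{\cdot+\top}$ is $A\curlyvee B=(A+B)+(A\times B)$ on objects and $f\curlyvee g=(f+g)+(f\times g)$ on Kleisli maps. Its symmetric monoidal structure has unit $\bot$ and structure isomorphisms the $J$-images of the following isomorphisms of $\mathbb{D}$. Put $\kappa^0_{A,B}=\iota^0_{A,B};\iota^0_{A+B,A\times B}:A\to A\curlyvee B$, $\kappa^1_{A,B}=\iota^1_{A,B};\iota^0_{A+B,A\times B}:B\to A\curlyvee B$, $\kappa^2_{A,B}=\iota^1_{A+B,A\times B}:A\times B\to A\curlyvee B$. Right unitor $\kappa^0_{A,\bot}:A\to A\curlyvee\bot$; left unitor $\kappa^1_{\bot,A}:A\to\bot\curlyvee A$; symmetry $\sigma^+_{A,B}+\sigma^\times_{A,B}$; associator $\alpha:(A\curlyvee B)\curlyvee C\to A\curlyvee(B\curlyvee C)$ the unique map with $\kappa^0_{A,B};\kappa^0_{A\curlyvee B,C};\alpha=\kappa^0_{A,B\curlyvee C}$; $\kappa^1_{A,B};\kappa^0_{A\curlyvee B,C};\alpha=\kappa^0_{B,C};\kappa^1_{A,B\curlyvee C}$; $\kappa^2_{A,B};\kappa^0_{A\curlyvee B,C};\alpha=(1_A\times\kappa^0_{B,C});\kappa^2_{A,B\curlyvee C}$; $\kappa^1_{A\curlyvee B,C};\alpha=\kappa^1_{B,C};\kappa^1_{A,B\curlyvee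 C}$; $(\kappa^0_{A,B}\times1_C);\kappa^2_{A\curlyvee B,C};\alpha=(1_A\times\kappa^1_{B,C});\kappa^2_{A,B\curlyvee C}$; $(\kappa^1_{A,B}\times1_C);\kappa^2_{A\curlyvee B,C};\alpha=\kappa^2_{B,C};\kappa^1_{A,B\curlyvee C}$; $(\kappa^2_{A,B}\times1_C);\kappa^2_{A\curlyvee B,C};\alpha=\alpha^\times_{A,B,C};(1_A\times\kappa^2_{B,C});\kappa^2_{A,B\curlyvee C}$. A linearly distributive category (LDC) is a category with two monoidal structures: a tensor $(\otimes,\mathbf{1})$ with isomorphisms $\alpha^\otimes_{A,B,C}:(A\otimes B)\otimes C\to A\otimes(B\otimes C)$, $r^\otimes_A:A\to A\otimes\mathbf{1}$, $l^\otimes_A:A\to\mathbf{1}\otimes A$, and a par, written here $(\odot,\bot)$, with isomorphisms $\alpha^\odot_{A,B,C}:A\odot(B\odot C)\to(A\odot B)\odot C$, $r^\odot_A:A\odot\bot\to A$, $l^\odot_A:\bot\odot A\to A$; together with natural transformations $\delta^R_{A,B,C}:(A\odot B)\otimes C\to A\odot(B\otimes C)$ and $\delta^L_{A,B,C}:A\otimes(B\odot C)\to(A\otimes B)\odot C$ such that: (1) $l^\otimes_{A\odot B};\delta^L_{\mathbf{1},A,B}=l^\otimes_A\odot1_B$; $r^\otimes_{A\odot B};\delta^R_{A,B,\mathbf{1}}=1_A\odot r^\otimes_B$; $\delta^R_{\bot,A,B};l^\odot_{A\otimes B}=l^\odot_A\otimes1_B$; $\delta^L_{A,B,\bot};r^\odot_{A\otimes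 B}=1_A\otimes r^\odot_B$. (2) $\delta^L_{A\otimes B,C,D};(\alpha^\otimes_{A,B,C}\odot1_D)=\alpha^\otimes_{A,B,C\odot D};(1_A\otimes\delta^L_{B,C,D});\delta^L_{A,B\otimes C,D}$; $(\alpha^\odot_{A,B,C}\otimes1_D);\delta^R_{A\odot B,C,D}=\delta^R_{A,B\odot C,D};(1_A\odot\delta^R_{B,C,D});\alpha^\odot_{A,B,C\otimes D}$; $\delta^L_{A,B,C\odot D};\alpha^\odot_{A\otimes B,C,D}=(1_A\otimes\alpha^\odot_{B,C,D});\delta^L_{A,B\odot C,D};(\delta^L_{A,B,C}\odot1_D)$; $\alpha^\otimes_{A\odot B,C,D};\delta^R_{A,B,C\otimes D}=(\delta^R_{A,B,C}\otimes1_D);\delta^R_{A,B\otimes C,D};(1_A\odot\alpha^\otimes_{B,C,D})$. (3) $\delta^L_{A\odot B,C,D};(\delta^R_{A,B,C}\odot1_D)=\delta^R_{A,B,C\odot D};(1_A\odot\delta^L_{B,C,D});\alpha^\odot_{A,B\otimes C,D}$; $(\delta^L_{A,B,C}\otimes1_D);\delta^R_{A\otimes B,C,D}=\alpha^\otimes_{A,B\odot C,D};(1_A\otimes\delta^R_{B,C,D});\delta^L_{A,B,C\otimes D}$. It is symmetric if both monoidal structures are symmetric, with symmetries $\sigma^\otimes,\sigma^\odot$, and (4) $\delta^R_{A,B,C}=\sigma^\otimes_{A\odot B,C};(1_C\otimes\sigma^\odot_{A,B});\delta^L_{C,B,A};(\sigma^\otimes_{C,B}\odot1_A);\sigma^\odot_{B\otimes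 C,A}$; in the symmetric case $\delta^R$ is thus determined by $\delta^L$. An LDC is mix if there is a map $m:\bot\to\mathbf{1}$ with $(1_A\otimes(l^\odot_B)^{-1});(1_A\otimes(m\odot1_B));\delta^L_{A,\mathbf{1},B};((r^\otimes_A)^{-1}\odot1_B)=((r^\odot_A)^{-1}\otimes1_B);((1_A\odot m)\otimes1_B);\delta^R_{A,\mathbf{1},B};(1_A\odot(l^\otimes_B)^{-1})$ for all $A,B$, and isomix if moreover $m$ is an isomorphism. *)

(* Defs.v *)
From Corelib Require Import ssreflect.

Set Implicit Arguments.
Unset Strict Implicit.
Unset Printing Implicit Defensive.

Declare Scope cat_scope.
Delimit Scope cat_scope with cat.
Local Open Scope cat_scope.

(* Composition is in diagrammatic order. *)
Record category := Category {
  Ob :> Type;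
  Hom : Ob -> Ob -> Type;
  idm : forall A, Hom A A;
  comp : forall A B C, Hom A B -> Hom B C -> Hom A C;
  comp1m : forall A B (f : Hom A B), comp (idm A) f = f;
  compm1 : forall A B (f : Hom A B), comp f (idm B) = f;
  compA : forall A B C E (f : Hom A B) (g : Hom B C) (h : Hom C E),
    comp f (comp g h) = comp (comp f g) h }.

Arguments idm {_} A.
Notation "f ;; g" := (comp f g) (at level 50, left associativity) : cat_scope.

Definition inverse_pair (C : category) (A B : C) (f : Hom A B) (g : Hom B A) : Prop :=
  f ;; g = idm A /\ g ;; f = idm B.

Definition is_iso (C : category) (A B : C) (f : Hom A B) : Prop :=
  exists g, inverse_pair f g.

Class finite_products (C : category) := FiniteProducts {
  terminal : C;
  to_terminal : forall A, Hom A terminal;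
  to_terminal_unique : forall A (f : Hom A terminal), f = to_terminal A;
  prodo : C -> C -> C;
  proj0 : forall A B, Hom (prodo A B) A;
  proj1 : forall A B, Hom (prodo A B) B;
  pair : forall X A B, Hom X A -> Hom X B -> Hom X (prodo A B);
  pair_proj0 : forall X A B (f : Hom X A) (g : Hom X B), pair f g ;; proj0 A B = f;
  pair_proj1 : forall X A B (f : Hom X A) (g : Hom X B), pair f g ;; proj1 A B = g;
  pair_unique : forall X A B (h : Hom X (prodo A B)),
    h = pair (h ;; proj0 A B) (h ;; proj1 A B) }.

Class finite_coproducts (C : category) := FiniteCoproducts {
  initial : C;
  from_initial : forall A, Hom initial A;
  from_initial_unique : forall A (f : Hom initial A), f = from_initial A;
  sumo : C -> C -> C;
  inj0 : forall A B, Hom A (sumo A B);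
  inj1 : forall A B, Hom B (sumo A B);
  copair : forall X A B, Hom A X -> Hom B X -> Hom (sumo A B) X;
  inj0_copair : forall X A B (f : Hom A X) (g : Hom B X), inj0 A B ;; copair f g = f;
  inj1_copair : forall X A B (f : Hom A X) (g : Hom B X), inj1 A B ;; copair f g = g;
  copair_unique : forall X A B (h : Hom (sumo A B) X),
    h = copair (inj0 A B ;; h) (inj1 A B ;; h) }.

Notation "'⊤'" := terminal : cat_scope.
Notation "'⊥'" := initial : cat_scope.
Notation "A × B" := (prodo A B) (at level 40, left associativity) : cat_scope.
Notation "A + B" := (sumo A B) : cat_scope.
Arguments proj0 {C _ A B}.
Arguments proj1 {C _ A B}.
Arguments inj0 {C _ A B}.
Arguments inj1 {C _ A B}.
Arguments to_terminal {C _ A}.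
Arguments from_initial {C _ A}.

Section Products.
Context {C : category} {P : finite_products C}.

Definition prodm (A A' B B' : C) (f : Hom A A') (g : Hom B B') : Hom (A × B) (A' × B') :=
  pair (proj0 ;; f) (proj1 ;; g).

Definition prod_swap (A B : C) : Hom (A × B) (B × A) := pair proj1 proj0.

Definition prod_assoc (X Y Z : C) : Hom ((X × Y) × Z) (X × (Y × Z)) :=
  pair (proj0 ;; proj0) (pair (proj0 ;; proj1) proj1).

Definition prod_assoc_inv (X Y Z : C) : Hom (X × (Y × Z)) ((X × Y) × Z) :=
  pair (pair proj0 (proj1 ;; proj0)) (proj1 ;; proj1).
End Products.

Section Coproducts.
Context {C : category} {Q : finite_coproducts C}.

Definition summ (A A' B B' : C) (f : Hom A A') (g : Hom B B') : Hom (A + B) (A' + B') :=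
  copair (f ;; inj0) (g ;; inj1).

Definition sum_swap (A B : C) : Hom (A + B) (B + A) := copair inj1 inj0.

Definition sum_assoc (X Y Z : C) : Hom ((X + Y) + Z) (X + (Y + Z)) :=
  copair (copair inj0 (inj0 ;; inj1)) (inj1 ;; inj1).

Definition sum_assoc_inv (X Y Z : C) : Hom (X + (Y + Z)) ((X + Y) + Z) :=
  copair (inj0 ;; inj0) (copair (inj1 ;; inj0) inj1).
End Coproducts.

Notation "f ×m g" := (prodm f g) (at level 40, left associativity) : cat_scope.
Notation "f +m g" := (summ f g) (at level 50, left associativity) : cat_scope.

Definition dist_map (C : category) {P : finite_products C} {Q : finite_coproducts C}
  (X Y Z : C) : Hom ((X × Y) + (X × Z)) (X × (Y + Z)) :=
  copair (idm X ×m inj0) (idm X ×m inj1).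

(* Being an isomorphism is a property of [dist_map]: its inverse, recorded here
   as data, is unique. *)
Record distributive_category := DistributiveCategory {
  dcat :> category;
  dcat_products : finite_products dcat;
  dcat_coproducts : finite_coproducts dcat;
  undist : forall A B C : dcat, Hom (A × (B + C)) ((A × B) + (A × C));
  dist_undist : forall A B C : dcat, inverse_pair (dist_map A B C) (undist A B C) }.

#[export] Existing Instance dcat_products.
#[export] Existing Instance dcat_coproducts.

Arguments undist {_} A B C.

(* The inverses of the structure isomorphisms are part of the data, so that the
   same record serves for a tensor, whose structure isomorphisms are oriented as
   [assoc], [runit], [lunit], and for a par, where they are oriented as
   [assoc_inv], [runit_inv], [lunit_inv]. *)
Record monoidal_data (C : category) := MonoidalData {
  tens : C -> C -> C;
  tensm : forall A A' B B', Hom A A' -> Hom B B' -> Hom (tens A B) (tens A' B');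
  munit : C;
  assoc : forall X Y Z, Hom (tens (tens X Y) Z) (tens X (tens Y Z));
  assoc_inv : forall X Y Z, Hom (tens X (tens Y Z)) (tens (tens X Y) Z);
  runit : forall A, Hom A (tens A munit);
  runit_inv : forall A, Hom (tens A munit) A;
  lunit : forall A, Hom A (tens munit A);
  lunit_inv : forall A, Hom (tens munit A) A }.

Arguments assoc {_} _ X Y Z.
Arguments assoc_inv {_} _ X Y Z.
Arguments runit {_} _ A.
Arguments runit_inv {_} _ A.
Arguments lunit {_} _ A.
Arguments lunit_inv {_} _ A.

Section Monoidal.
Context {C : category} (M : monoidal_data C).
Local Notation "A ⊗ B" := (tens M A B) (at level 40, left associativity).
Local Notation "f ⊗m g" := (tensm M f g) (at level 40, left associativity).
Local Notation "'I'" := (munit M).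

Record is_monoidal : Prop := {
  tensm1 : forall A B : C, idm A ⊗m idm B = idm (A ⊗ B);
  tensmM : forall (A A' A'' B B' B'' : C) (f : Hom A A') (f' : Hom A' A'')
      (g : Hom B B') (g' : Hom B' B''),
    (f ;; f') ⊗m (g ;; g') = (f ⊗m g) ;; (f' ⊗m g');
  assocK : forall X Y Z : C, inverse_pair (assoc M X Y Z) (assoc_inv M X Y Z);
  runitK : forall A : C, inverse_pair (runit M A) (runit_inv M A);
  lunitK : forall A : C, inverse_pair (lunit M A) (lunit_inv M A);
  assoc_natural : forall (X X' Y Y' Z Z' : C)
      (f : Hom X X') (g : Hom Y Y') (h : Hom Z Z'),
    ((f ⊗m g) ⊗m h) ;; assoc M X' Y' Z' = assoc M X Y Z ;; (f ⊗m (g ⊗m h));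
  runit_natural : forall (A A' : C) (f : Hom A A'),
    f ;; runit M A' = runit M A ;; (f ⊗m idm I);
  lunit_natural : forall (A A' : C) (f : Hom A A'),
    f ;; lunit M A' = lunit M A ;; (idm I ⊗m f);
  pentagon : forall W X Y Z : C,
    assoc M (W ⊗ X) Y Z ;; assoc M W X (Y ⊗ Z)
    = (assoc M W X Y ⊗m idm Z) ;; assoc M W (X ⊗ Y) Z ;; (idm W ⊗m assoc M X Y Z);
  triangle : forall A B : C,
    (runit M A ⊗m idm B) ;; assoc M A I B = idm A ⊗m lunit M B }.

Record is_symmetry (s : forall A B : C, Hom (A ⊗ B) (B ⊗ A)) : Prop := {
  symm_natural : forall (A A' B B' : C) (f : Hom A A') (g : Hom B B'),
    (f ⊗m g) ;; s A' B' = s A B ;; (g ⊗m f);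
  symmK : forall A B : C, s A B ;; s B A = idm (A ⊗ B);
  hexagon : forall X Y Z : C,
    assoc M X Y Z ;; s X (Y ⊗ Z) ;; assoc M Y Z X
    = (s X Y ⊗m idm Z) ;; assoc M Y X Z ;; (idm Y ⊗m s X Z) }.
End Monoidal.

Section LinearlyDistributive.
Context {K : category} (T P : monoidal_data K).
Local Notation "A ⊗ B" := (tens T A B) (at level 40, left associativity).
Local Notation "f ⊗m g" := (tensm T f g) (at level 40, left associativity).
Local Notation "A ⊙ B" := (tens P A B) (at level 40, left associativity).
Local Notation "f ⊙m g" := (tensm P f g) (at level 40, left associativity).
Local Notation "'I'" := (munit T).
Local Notation "'O'" := (munit P).
Local Notation "'αt'" := (assoc T).
Local Notation "'rt'" := (runit T).
Local Notation "'lt'" := (lunit T).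
Local Notation "'αp'" := (assoc_inv P).
Local Notation "'rp'" := (runit_inv P).
Local Notation "'lp'" := (lunit_inv P).

Definition left_distributor := forall A B C : K, Hom (A ⊗ (B ⊙ C)) ((A ⊗ B) ⊙ C).
Definition right_distributor := forall A B C : K, Hom ((A ⊙ B) ⊗ C) (A ⊙ (B ⊗ C)).

Record is_LDC (δR : right_distributor) (δL : left_distributor) : Prop := {
  LDC_tensor : is_monoidal T;
  LDC_par : is_monoidal P;
  δL_natural : forall (A A' B B' C C' : K) (f : Hom A A') (g : Hom B B') (h : Hom C C'),
    (f ⊗m (g ⊙m h)) ;; δL A' B' C' = δL A B C ;; ((f ⊗m g) ⊙m h);
  δR_natural : forall (A A' B B' C C' : K) (f : Hom A A') (g : Hom B B') (h : Hom C C'),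
    ((f ⊙m g) ⊗m h) ;; δR A' B' C' = δR A B C ;; (f ⊙m (g ⊗m h));
  δL_lunit : forall A B : K, lt (A ⊙ B) ;; δL I A B = lt A ⊙m idm B;
  δR_runit : forall A B : K, rt (A ⊙ B) ;; δR A B I = idm A ⊙m rt B;
  δR_lunit : forall A B : K, δR O A B ;; lp (A ⊗ B) = lp A ⊗m idm B;
  δL_runit : forall A B : K, δL A B O ;; rp (A ⊗ B) = idm A ⊗m rp B;
  δL_assoc_tensor : forall A B C D : K,
    δL (A ⊗ B) C D ;; (αt A B C ⊙m idm D)
    = αt A B (C ⊙ D) ;; (idm A ⊗m δL B C D) ;; δL A (B ⊗ C) D;
  δR_assoc_par : forall A B C D : K,
    (αp A B C ⊗m idm D) ;; δR (A ⊙ B) C D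
    = δR A (B ⊙ C) D ;; (idm A ⊙m δR B C D) ;; αp A B (C ⊗ D);
  δL_assoc_par : forall A B C D : K,
    δL A B (C ⊙ D) ;; αp (A ⊗ B) C D
    = (idm A ⊗m αp B C D) ;; δL A (B ⊙ C) D ;; (δL A B C ⊙m idm D);
  δR_assoc_tensor : forall A B C D : K,
    αt (A ⊙ B) C D ;; δR A B (C ⊗ D)
    = (δR A B C ⊗m idm D) ;; δR A (B ⊗ C) D ;; (idm A ⊙m αt B C D);
  δL_δR : forall A B C D : K,
    δL (A ⊙ B) C D ;; (δR A B C ⊙m idm D)
    = δR A B (C ⊙ D) ;; (idm A ⊙m δL B C D) ;; αp A (B ⊗ C) D;
  δR_δL : forall A B C D : K,
    (δL A B C ⊗m idm D) ;; δR (A ⊗ B) C D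
    = αt A (B ⊙ C) D ;; (idm A ⊗m δR B C D) ;; δL A B (C ⊗ D) }.

Record is_symmetric_LDC (σt : forall A B : K, Hom (A ⊗ B) (B ⊗ A))
    (σp : forall A B : K, Hom (A ⊙ B) (B ⊙ A))
    (δR : right_distributor) (δL : left_distributor) : Prop := {
  symmetric_LDC_LDC : is_LDC δR δL;
  symmetric_LDC_tensor : is_symmetry σt;
  symmetric_LDC_par : is_symmetry σp;
  symmetric_LDC_δR : forall A B C : K,
    δR A B C = σt (A ⊙ B) C ;; (idm C ⊗m σp A B) ;; δL C B A
               ;; (σt C B ⊙m idm A) ;; σp (B ⊗ C) A }.

Definition is_mix_map (δR : right_distributor) (δL : left_distributor) (m : Hom O I) : Prop :=
  forall A B : K,
    (idm A ⊗m lunit P B) ;; (idm A ⊗m (m ⊙m idm B)) ;; δL A I B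
      ;; (runit_inv T A ⊙m idm B)
    = (runit P A ⊗m idm B) ;; ((idm A ⊙m m) ⊗m idm B) ;; δR A I B
      ;; (idm A ⊙m lunit_inv T B).

Definition is_isomix (δR : right_distributor) (δL : left_distributor) : Prop :=
  exists m : Hom O I, is_iso m /\ is_mix_map δR δL m.
End LinearlyDistributive.

Definition cocartesian_data (C : category) (Q : finite_coproducts C) : monoidal_data C :=
  {| tens := sumo;
     tensm := @summ C Q;
     munit := ⊥;
     assoc := sum_assoc;
     assoc_inv := sum_assoc_inv;
     runit := fun A => inj0;
     runit_inv := fun A => copair (idm A) from_initial;
     lunit := fun A => inj1;
     lunit_inv := fun A => copair from_initial (idm A) |}.

Section CoproductFacts.
Context {C : category} {Q : finite_coproducts C}.

Lemma copair_comp (X Y A B : C) (f : Hom A X) (g : Hom B X) (h : Hom X Y) :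
  copair f g ;; h = copair (f ;; h) (g ;; h).
Proof. by rewrite [LHS]copair_unique !compA inj0_copair inj1_copair. Qed.

Lemma copair_inj (A B : C) : copair inj0 inj1 = idm (A + B).
Proof. by rewrite [RHS]copair_unique !compm1. Qed.

Lemma summ_copair (X A A' B B' : C) (f : Hom A A') (g : Hom B B')
    (h : Hom A' X) (k : Hom B' X) :
  (f +m g) ;; copair h k = copair (f ;; h) (g ;; k).
Proof. by rewrite copair_comp -!compA inj0_copair inj1_copair. Qed.
End CoproductFacts.

Section DistributiveFacts.
Variable D : distributive_category.

Lemma copair_ext (X A B : D) (h k : Hom (A + B) X) :
  inj0 ;; h = inj0 ;; k -> inj1 ;; h = inj1 ;; k -> h = k.
Proof. by move=> e0 e1; rewrite [LHS]copair_unique [RHS]copair_unique e0 e1. Qed.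

Lemma pair_ext (X A B : D) (h k : Hom X (A × B)) :
  h ;; proj0 = k ;; proj0 -> h ;; proj1 = k ;; proj1 -> h = k.
Proof. by move=> e0 e1; rewrite [LHS]pair_unique [RHS]pair_unique e0 e1. Qed.

Lemma prodm_comp (A A' A'' B B' B'' : D) (f : Hom A A') (f' : Hom A' A'')
    (g : Hom B B') (g' : Hom B' B'') :
  (f ×m g) ;; (f' ×m g') = (f ;; f') ×m (g ;; g').
Proof.
by apply: pair_ext; rewrite /prodm -!compA ?pair_proj0 ?pair_proj1 !compA
  ?pair_proj0 ?pair_proj1.
Qed.

Lemma prodm_split (A A' B B' : D) (f : Hom A A') (g : Hom B B') :
  f ×m g = (idm A ×m g) ;; (f ×m idm B').
Proof. by rewrite prodm_comp comp1m compm1. Qed.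

Lemma prodm_swap (A A' B B' : D) (f : Hom A A') (g : Hom B B') :
  (f ×m g) ;; prod_swap A' B' = prod_swap A B ;; (g ×m f).
Proof.
by apply: pair_ext; rewrite /prodm /prod_swap -!compA ?pair_proj0 ?pair_proj1
  !compA ?pair_proj0 ?pair_proj1.
Qed.

Lemma prod_swapK (A B : D) : prod_swap A B ;; prod_swap B A = idm (A × B).
Proof.
by apply: pair_ext; rewrite /prod_swap -!compA ?pair_proj0 ?pair_proj1
  comp1m ?pair_proj0 ?pair_proj1.
Qed.

Lemma inj0_summ (A A' B B' : D) (f : Hom A A') (g : Hom B B') :
  inj0 ;; (f +m g) = f ;; inj0.
Proof. by rewrite inj0_copair. Qed.

Lemma inj1_summ (A A' B B' : D) (f : Hom A A') (g : Hom B B') :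
  inj1 ;; (f +m g) = g ;; inj1.
Proof. by rewrite inj1_copair. Qed.

Lemma inj0_undist (A B C : D) : (idm A ×m inj0) ;; undist A B C = inj0.
Proof.
have [e _] := dist_undist A B C.
by rewrite -[RHS]compm1 -e compA /dist_map inj0_copair.
Qed.

Lemma inj1_undist (A B C : D) : (idm A ×m inj1) ;; undist A B C = inj1.
Proof.
have [e _] := dist_undist A B C.
by rewrite -[RHS]compm1 -e compA /dist_map inj1_copair.
Qed.

Lemma undist_ext (X A B C : D) (h k : Hom (A × (B + C)) X) :
  (idm A ×m inj0) ;; h = (idm A ×m inj0) ;; k ->
  (idm A ×m inj1) ;; h = (idm A ×m inj1) ;; k -> h = k.
Proof.
move=> e0 e1; have [_ e] := dist_undist A B C.
rewrite -[h]comp1m -[k]comp1m -e -!compA; congr (_ ;; _).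
by apply: copair_ext; rewrite /dist_map !compA ?inj0_copair ?inj1_copair.
Qed.

Definition undistR (A B C : D) : Hom ((A + B) × C) ((A × C) + (B × C)) :=
  prod_swap (A + B) C ;; undist C A B ;; (prod_swap C A +m prod_swap C B).

Lemma inj0_undistR (A B C : D) : (inj0 ×m idm C) ;; undistR A B C = inj0.
Proof.
rewrite /undistR !compA prodm_swap -(compA (prod_swap _ _)) inj0_undist -compA.
by rewrite inj0_summ compA prod_swapK comp1m.
Qed.

Lemma inj1_undistR (A B C : D) : (inj1 ×m idm C) ;; undistR A B C = inj1.
Proof.
rewrite /undistR !compA prodm_swap -(compA (prod_swap _ _)) inj1_undist -compA.
by rewrite inj1_summ compA prod_swapK comp1m.
Qed.

Lemma undistR_ext (X A B C : D) (h k : Hom ((A + B) × C) X) :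
  (inj0 ×m idm C) ;; h = (inj0 ×m idm C) ;; k ->
  (inj1 ×m idm C) ;; h = (inj1 ×m idm C) ;; k -> h = k.
Proof.
move=> e0 e1; rewrite -[h]comp1m -[k]comp1m -prod_swapK -!compA; congr (_ ;; _).
by apply: undist_ext; rewrite !compA !prodm_swap -!compA ?e0 ?e1.
Qed.

End DistributiveFacts.

Section Kleisli.
Variable D : distributive_category.

Definition exc_unit (A : D) : Hom A (A + ⊤) := inj0.
Definition exc_mult (A : D) : Hom ((A + ⊤) + ⊤) (A + ⊤) := copair (idm (A + ⊤)) inj1.

Definition kcomp (A B C : D) (f : Hom A (B + ⊤)) (g : Hom B (C + ⊤)) : Hom A (C + ⊤) :=
  f ;; (g +m idm ⊤) ;; exc_mult C.

Lemma kcompE (A B C : D) (f : Hom A (B + ⊤)) (g : Hom B (C + ⊤)) :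
  kcomp f g = f ;; copair g inj1.
Proof. by rewrite /kcomp /exc_mult -compA summ_copair compm1 comp1m. Qed.

Lemma kcomp1m (A B : D) (f : Hom A (B + ⊤)) : kcomp (exc_unit A) f = f.
Proof. by rewrite kcompE inj0_copair. Qed.

Lemma kcompm1 (A B : D) (f : Hom A (B + ⊤)) : kcomp f (exc_unit B) = f.
Proof. by rewrite kcompE copair_inj compm1. Qed.

Lemma kcompA (A B C E : D) (f : Hom A (B + ⊤)) (g : Hom B (C + ⊤)) (h : Hom C (E + ⊤)) :
  kcomp f (kcomp g h) = kcomp (kcomp f g) h.
Proof. by rewrite !kcompE -compA copair_comp inj1_copair. Qed.

Definition kleisli : category :=
  {| Ob := Ob D;
     Hom := fun A B => Hom A (B + ⊤);
     idm := exc_unit;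
     comp := kcomp;
     comp1m := kcomp1m;
     compm1 := kcompm1;
     compA := kcompA |}.

Definition J (A B : D) (f : Hom A B) : @Hom kleisli A B := f ;; exc_unit B.

Lemma kfrom_initial_unique (A : D) (f : @Hom kleisli (initial (C := D)) A) :
  f = J from_initial.
Proof. by rewrite [LHS](from_initial_unique (C := D)) [RHS](from_initial_unique (C := D)). Qed.

Lemma kinj0_copair (X A B : D) (f : Hom A (X + ⊤)) (g : Hom B (X + ⊤)) :
  kcomp (J inj0) (copair f g) = f.
Proof. by rewrite kcompE -compA !inj0_copair. Qed.

Lemma kinj1_copair (X A B : D) (f : Hom A (X + ⊤)) (g : Hom B (X + ⊤)) :
  kcomp (J inj1) (copair f g) = g.
Proof. by rewrite kcompE -compA inj0_copair inj1_copair. Qed.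

Lemma kcopair_unique (X A B : D) (h : Hom (A + B) (X + ⊤)) :
  h = copair (kcomp (J inj0) h) (kcomp (J inj1) h).
Proof. by rewrite !kcompE -!compA inj0_copair -copair_unique. Qed.

(* Not declared as an instance: [A + B] and [f +m g] below refer to D, and the
   coproduct in the Kleisli category is selected explicitly. *)
Definition kleisli_coproducts : finite_coproducts kleisli :=
  @FiniteCoproducts kleisli (initial (C := D))
    (fun A => J from_initial) kfrom_initial_unique (sumo (C := D))
    (fun A B => J inj0) (fun A B => J inj1) (fun X A B f g => copair (C := D) f g)
    kinj0_copair kinj1_copair kcopair_unique.

Definition ksumm (A A' B B' : D) (f : @Hom kleisli A A') (g : @Hom kleisli B B') :
  @Hom kleisli (A + B) (A' + B') := @summ kleisli kleisli_coproducts A A' B B' f g.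

Definition exc_dist (A B : D) :
    Hom ((A × B) + ((A × ⊤) + (⊤ × (B + ⊤)))) ((A + ⊤) × (B + ⊤)) :=
  copair (inj0 ×m inj0) (copair (inj0 ×m inj1) (inj1 ×m idm (B + ⊤))).

(* The inverse of [exc_dist], see [exc_dist_undist]. *)
Definition exc_undist (A B : D) :
    Hom ((A + ⊤) × (B + ⊤)) ((A × B) + ((A × ⊤) + (⊤ × (B + ⊤)))) :=
  undistR A ⊤ (B + ⊤) ;; (undist A B ⊤ +m idm (⊤ × (B + ⊤))) ;; sum_assoc _ _ _.

Lemma inj00_exc_undist (A B : D) : (inj0 ×m inj0) ;; exc_undist A B = inj0.
Proof.
rewrite prodm_split /exc_undist 2!compA -(compA _ _ (undistR _ _ _)) inj0_undistR.
rewrite -(compA _ inj0) inj0_summ !compA inj0_undist.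
by rewrite /sum_assoc -!compA !inj0_copair.
Qed.

Lemma inj01_exc_undist (A B : D) : (inj0 ×m inj1) ;; exc_undist A B = inj0 ;; inj1.
Proof.
rewrite prodm_split /exc_undist 2!compA -(compA _ _ (undistR _ _ _)) inj0_undistR.
rewrite -(compA _ inj0) inj0_summ !compA inj1_undist.
by rewrite /sum_assoc -!compA !inj0_copair inj1_copair.
Qed.

Lemma inj1_exc_undist (A B : D) :
  (inj1 ×m idm (B + ⊤)) ;; exc_undist A B = inj1 ;; inj1.
Proof.
by rewrite /exc_undist 2!compA inj1_undistR inj1_summ comp1m /sum_assoc inj1_copair.
Qed.

Lemma exc_dist_undist (A B : D) : inverse_pair (exc_dist A B) (exc_undist A B).
Proof.
split.
  rewrite /exc_dist copair_comp copair_comp inj00_exc_undist inj01_exc_undist.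
  by rewrite inj1_exc_undist -copair_comp copair_inj comp1m copair_inj.
apply: undistR_ext; first apply: undist_ext.
- by rewrite compm1 2!compA -prodm_split inj00_exc_undist inj0_copair.
- rewrite compm1 2!compA -prodm_split inj01_exc_undist.
  by rewrite /exc_dist -compA inj1_copair inj0_copair.
- by rewrite compm1 compA inj1_exc_undist /exc_dist -compA !inj1_copair.
Qed.

Definition kprodm (A A' B B' : D) (f : @Hom kleisli A A') (g : @Hom kleisli B B') :
    @Hom kleisli (A × B) (A' × B') :=
  prodm (C := D) f g ;; exc_undist A' B' ;; (idm (A' × B') +m to_terminal).

Definition curly (A B : D) : D := (A + B) + (A × B).
Local Notation "A ⋎ B" := (curly A B) (at level 50, left associativity).

Definition kcurlym (A A' B B' : D) (f : @Hom kleisli A A') (g : @Hom kleisli B B') :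
    @Hom kleisli (A ⋎ B) (A' ⋎ B') :=
  ksumm (ksumm f g) (kprodm f g).

Definition κ0 (A B : D) : Hom A (A ⋎ B) := inj0 ;; inj0.
Definition κ1 (A B : D) : Hom B (A ⋎ B) := inj1 ;; inj0.
Definition κ2 (A B : D) : Hom (A × B) (A ⋎ B) := inj1.

Definition curly_symm (A B : D) : Hom (A ⋎ B) (B ⋎ A) := sum_swap A B +m prod_swap A B.

Definition curly_runit_inv (A : D) : Hom (A ⋎ ⊥) A :=
  copair (copair (idm A) from_initial) proj0.

Definition curly_lunit_inv (A : D) : Hom (⊥ ⋎ A) A :=
  copair (copair from_initial (idm A)) proj1.

Definition curly_assoc_spec (A B C : D) (α : Hom ((A ⋎ B) ⋎ C) (A ⋎ (B ⋎ C))) : Prop :=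
  κ0 A B ;; κ0 (A ⋎ B) C ;; α = κ0 A (B ⋎ C) /\
  κ1 A B ;; κ0 (A ⋎ B) C ;; α = κ0 B C ;; κ1 A (B ⋎ C) /\
  κ2 A B ;; κ0 (A ⋎ B) C ;; α = (idm A ×m κ0 B C) ;; κ2 A (B ⋎ C) /\
  κ1 (A ⋎ B) C ;; α = κ1 B C ;; κ1 A (B ⋎ C) /\
  (κ0 A B ×m idm C) ;; κ2 (A ⋎ B) C ;; α = (idm A ×m κ1 B C) ;; κ2 A (B ⋎ C) /\
  (κ1 A B ×m idm C) ;; κ2 (A ⋎ B) C ;; α = κ2 B C ;; κ1 A (B ⋎ C) /\
  (κ2 A B ×m idm C) ;; κ2 (A ⋎ B) C ;; α
    = prod_assoc A B C ;; (idm A ×m κ2 B C) ;; κ2 A (B ⋎ C).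

(* The unique map satisfying [curly_assoc_spec], see [curly_assocP] and
   [curly_assoc_unique]. *)
Definition curly_assoc (A B C : D) : Hom ((A ⋎ B) ⋎ C) (A ⋎ (B ⋎ C)) :=
  copair
    (copair
       (copair (copair (κ0 A (B ⋎ C)) (κ0 B C ;; κ1 A (B ⋎ C)))
               ((idm A ×m κ0 B C) ;; κ2 A (B ⋎ C)))
       (κ1 B C ;; κ1 A (B ⋎ C)))
    (undistR (A + B) (A × B) C ;;
     copair
       (undistR A B C ;;
        copair ((idm A ×m κ1 B C) ;; κ2 A (B ⋎ C)) (κ2 B C ;; κ1 A (B ⋎ C)))
       (prod_assoc A B C ;; (idm A ×m κ2 B C) ;; κ2 A (B ⋎ C))).

Lemma curly_assocP (A B C : D) : curly_assoc_spec (curly_assoc A B C).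
Proof.
have κ2E X (f : Hom X (A ⋎ B)) :
    (f ×m idm C) ;; κ2 (A ⋎ B) C ;; curly_assoc A B C
    = (f ×m idm C) ;; (undistR (A + B) (A × B) C ;;
     copair
       (undistR A B C ;;
        copair ((idm A ×m κ1 B C) ;; κ2 A (B ⋎ C)) (κ2 B C ;; κ1 A (B ⋎ C)))
       (prod_assoc A B C ;; (idm A ×m κ2 B C) ;; κ2 A (B ⋎ C))).
  by rewrite -compA inj1_copair.
have κE X (f : Hom X (A + B)) :
    ((f ;; inj0) ×m idm C) ;; κ2 (A ⋎ B) C ;; curly_assoc A B C
    = (f ×m idm C) ;; (undistR A B C ;;
        copair ((idm A ×m κ1 B C) ;; κ2 A (B ⋎ C)) (κ2 B C ;; κ1 A (B ⋎ C))).
  rewrite κ2E -[idm C]comp1m -prodm_comp comp1m -compA; congr (_ ;; _).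
  by rewrite compA inj0_undistR inj0_copair.
split; last split; last split; last split; last split; last split.
- by rewrite /κ0 -!compA !inj0_copair.
- by rewrite /κ1 /κ0 -!compA !inj0_copair inj1_copair /κ0 /κ1 -!compA.
- by rewrite /κ2 /κ0 -!compA !inj0_copair inj1_copair /κ0 /κ2.
- by rewrite /κ1 -!compA inj0_copair inj1_copair /κ1 -!compA.
- by rewrite κE compA inj0_undistR inj0_copair.
- by rewrite κE compA inj1_undistR inj1_copair.
- by rewrite κ2E compA inj1_undistR inj1_copair.
Qed.

Lemma curly_assoc_unique (A B C : D) (α : Hom ((A ⋎ B) ⋎ C) (A ⋎ (B ⋎ C))) :
  curly_assoc_spec α -> α = curly_assoc A B C.
Proof.
have [p0 [p1 [p2 [p3 [p4 [p5 p6]]]]]] := curly_assocP A B C.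
move=> [q0 [q1 [q2 [q3 [q4 [q5 q6]]]]]].
rewrite -{}p0 in q0; rewrite -{}p1 in q1; rewrite -{}p2 in q2; rewrite -{}p3 in q3.
rewrite -{}p4 in q4; rewrite -{}p5 in q5; rewrite -{}p6 in q6.
have split_r X (f : Hom X (A + B)) (h : Hom ((A ⋎ B) ⋎ C) (A ⋎ (B ⋎ C))) :
    ((f ;; inj0) ×m idm C) ;; κ2 (A ⋎ B) C ;; h
    = (f ×m idm C) ;; ((inj0 ×m idm C) ;; (inj1 ;; h)).
  by rewrite -[idm C in LHS]comp1m -prodm_comp -!compA.
rewrite !{}split_r in q4 q5; rewrite -!compA in q0 q1 q2 q3 q6.
apply: copair_ext; last by apply: undistR_ext => //; apply: undistR_ext.
by do 3?[apply: copair_ext => //].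
Qed.

Definition curly_assoc_inv (A B C : D) : Hom (A ⋎ (B ⋎ C)) ((A ⋎ B) ⋎ C) :=
  copair
    (copair
       (κ0 A B ;; κ0 (A ⋎ B) C)
       (copair (copair (κ1 A B ;; κ0 (A ⋎ B) C) (κ1 (A ⋎ B) C))
               ((κ1 A B ×m idm C) ;; κ2 (A ⋎ B) C)))
    (undist A (B + C) (B × C) ;;
     copair
       (undist A B C ;;
        copair (κ2 A B ;; κ0 (A ⋎ B) C) ((κ0 A B ×m idm C) ;; κ2 (A ⋎ B) C))
       (prod_assoc_inv A B C ;; (κ2 A B ×m idm C) ;; κ2 (A ⋎ B) C)).

Definition curly_data : monoidal_data kleisli :=
  {| tens := curly : kleisli -> kleisli -> kleisli;
     tensm := kcurlym;
     munit := initial (C := D);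
     assoc := fun A B C => J (curly_assoc A B C);
     assoc_inv := fun A B C => J (curly_assoc_inv A B C);
     runit := fun A => J (κ0 A ⊥);
     runit_inv := fun A => J (curly_runit_inv A);
     lunit := fun A => J (κ1 ⊥ A);
     lunit_inv := fun A => J (curly_lunit_inv A) |}.

Definition curly_symmetry (A B : D) : @Hom kleisli (A ⋎ B) (B ⋎ A) :=
  J (curly_symm A B).

Definition plus_data : monoidal_data kleisli := cocartesian_data kleisli_coproducts.

Definition plus_symmetry (A B : D) : @Hom kleisli (A + B) (B + A) :=
  @sum_swap kleisli kleisli_coproducts A B.

Definition curly_plus_δL (A B C : D) : @Hom kleisli (A ⋎ (B + C)) ((A ⋎ B) + C) :=
  copair
    (copair
       (inj0 ;; inj0 ;; inj0 ;; inj0)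
       (copair (inj1 ;; inj0 ;; inj0 ;; inj0)
               (inj1 ;; inj0)))
    (undist A B C ;; (idm (A × B) +m to_terminal) ;; (inj1 +m idm ⊤) ;; (inj0 +m idm ⊤)).

End Kleisli.

(* Main.v *)
From Corelib Require Import ssreflect.
Require Import Defs.

Set Implicit Arguments.
Unset Strict Implicit.
Unset Printing Implicit Defensive.

Local Open Scope cat_scope.

(** Think of [D] as sets.  Kleisli maps are then partial maps, and an element
    of [curly A B = (A + B) + (A × B)] is a nonempty choice of elements, at most
    one from [A] and at most one from [B].  The structure maps of both monoidal
    structures only move elements around; [curly_plus_δL] does so too, except
    that it is undefined on the pairs [(a, c)] with [a] in [A] and [c] in [C],
    which have no place in [curly A B + C].  Symmetry determines the right
    distributor from the left one.  The mix map is the identity of [⊥], and each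
    law becomes a check on elements: both sides send an element such as
    [((a, b), c)] to the same element, or both are undefined there.

    The same check works in an arbitrary distributive category with generalized
    elements.  A map [X -> A + B] does not factor through a summand in general,
    so arbitrary elements cannot be analysed by cases.  It is enough, however,
    to test maps on the elements assembled from injections and pairings of
    elements of the atoms: distributivity makes these jointly epic, even after
    taking the product with a further object, which is what the induction needs
    ([total_stable_ext], [total_ext]).

    Since naturality concerns all Kleisli maps, including partial ones, the
    elements of the atoms have to be partial as well, that is, maps
    [X -> A + ⊤].  Their pairing [kpair] is undefined as soon as one component
    is; it is natural ([kpair_kprodm]) and associative and symmetric
    ([kpair_assoc], [kpair_swap]).  A Kleisli map is realized by a function on
    formal elements when it acts on partial elements as this function says
    ([realizes]).  Realizers compose, every structure map has one, and two maps
    with equal realizers are equal ([realizes_ext]).  The realizer of a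
    composite is found by following its syntax, and comparing two realizers is a
    case analysis whose branches hold by computation; this is the tactic
    [coherence], which proves every law. *)

(** * Objects as polynomials and their elements *)

Section Elements.
Variable D : distributive_category.

(** A reading of an object as a polynomial in atoms.  Indexing by the object
    itself lets unification find the codes of the objects inside a composite. *)
Inductive code : D -> Type :=
| Var A : code A
| Zero : code ⊥
| Sum A B : code A -> code B -> code (A + B)
| Prod A B : code A -> code B -> code (A × B).

Definition Curly (A B : D) (p : code A) (q : code B) : code (curly A B) :=
  Sum (Sum p q) (Prod p q).

(** [V A] are the elements of the atom [A]: they will be total or partial. *)
Fixpoint elem (V : D -> Type) (A : D) (p : code A) : Type :=
  match p with
  | Var A => V A
  | Zero => Empty_set
  | Sum p q => sum (elem V p) (elem V q)
  | Prod p q => prod (elem V p) (elem V q)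
  end.

Fixpoint map_elem (V W : D -> Type) (u : forall A, V A -> W A) (A : D) (p : code A) :
    elem V p -> elem W p :=
  match p return elem V p -> elem W p with
  | Var A => u A
  | Zero => fun e => match e with end
  | Sum p q => fun e =>
      match e with
      | inl a => inl (map_elem u a)
      | inr b => inr (map_elem u b)
      end
  | Prod p q => fun e => (map_elem u (fst e), map_elem u (snd e))
  end.

Fixpoint total (X A : D) (p : code A) : elem (Hom X) p -> Hom X A :=
  match p in code A return elem (Hom X) p -> Hom X A with
  | Var A => fun x => x
  | Zero => fun e => match e with end
  | Sum p q => fun e =>
      match e with
      | inl a => total a ;; inj0
      | inr b => total b ;; inj1
      end
  | Prod p q => fun e => pair (total (fst e)) (total (snd e))
  end.

Lemma comp_pair (X Y A B : D) (u : Hom Y X) (f : Hom X A) (g : Hom X B) :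
  u ;; pair f g = pair (u ;; f) (u ;; g).
Proof. by apply: pair_ext; rewrite -compA ?pair_proj0 ?pair_proj1. Qed.

Lemma pair_prodm (X A A' B B' : D) (x : Hom X A) (y : Hom X B)
    (f : Hom A A') (g : Hom B B') :
  pair x y ;; (f ×m g) = pair (x ;; f) (y ;; g).
Proof. by rewrite /prodm comp_pair !compA pair_proj0 pair_proj1. Qed.

Lemma prod_assocK (A B C : D) : prod_assoc A B C ;; prod_assoc_inv A B C = idm _.
Proof.
apply: pair_ext; first apply: pair_ext.
all: rewrite /prod_assoc_inv /prod_assoc.
all: by repeat rewrite ?comp_pair ?pair_proj0 ?pair_proj1 ?compA ?comp1m.
Qed.

Lemma total_precomp (X Y A : D) (u : Hom Y X) (p : code A) (e : elem (Hom X) p) :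
  total (map_elem (fun A => comp u (C := A)) e) = u ;; total e.
Proof.
elim: p e => [A1||A1 B p IHp q IHq|A1 B p IHp q IHq].
all: move=> e //=.
- by case: e => [a|b]; rewrite ?IHp ?IHq compA.
- by rewrite IHp IHq comp_pair.
Qed.

(** Binary distributivity suffices: as both injections of [⊥] into [⊥ + ⊥]
    agree, so do both injections of [⊥ × Y] into [⊥ × Y + ⊥ × Y]. *)
Lemma prod_initial_subsingleton (Y Z : D) (h k : Hom (⊥ × Y) Z) : h = k.
Proof.
have e : @inj0 _ _ (⊥ × Y) (⊥ × Y) = inj1.
  rewrite -(inj0_undistR ⊥ ⊥ Y) -(inj1_undistR ⊥ ⊥ Y).
  by rewrite (from_initial_unique inj0) (from_initial_unique inj1).
by rewrite -(inj0_copair h k) e inj1_copair.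
Qed.

(** The parameter [Y] makes the induction work: for a sum it is carried along by
    distributivity, and for a product it absorbs the factor that is not being
    analysed. *)
Lemma total_stable_ext (A : D) (p : code A) (Y Z : D) (h k : Hom (A × Y) Z) :
  (forall X (e : elem (Hom X) p) (y : Hom X Y),
     pair (total e) y ;; h = pair (total e) y ;; k) ->
  h = k.
Proof.
elim: p Y Z h k => [A0||A0 B p IHp q IHq|A0 B p IHp q IHq] Y Z h k hk.
- have pairE : pair proj0 proj1 = idm (A0 × Y).
    by apply: pair_ext; rewrite ?pair_proj0 ?pair_proj1 comp1m.
  rewrite -[h]comp1m -[k]comp1m -pairE.
  exact: (hk (A0 × Y) (proj0 (B := Y)) proj1).
- exact: prod_initial_subsingleton.
- apply: undistR_ext; [apply: IHp|apply: IHq] => X e y.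
  + by have := hk X (inl e) y; rewrite !compA !pair_prodm compm1.
  + by have := hk X (inr e) y; rewrite !compA !pair_prodm compm1.
- suff assoc_hk : prod_assoc_inv _ _ _ ;; h = prod_assoc_inv _ _ _ ;; k.
    by rewrite -[h]comp1m -[k]comp1m -prod_assocK -!compA assoc_hk.
  apply: IHp => X e w.
  (* [r] remembers [X] beside [Y], so that the element [e] of the first factor
     can still be formed after the second factor has been analysed. *)
  pose (r := pair (pair (proj1 ;; proj0 ;; total e) proj0) (proj1 ;; proj1)
    : Hom (B × (X × Y)) (A0 × B × Y)).
  have wE : pair (total e) w ;; prod_assoc_inv A0 B Y
      = pair (w ;; proj0) (pair (idm X) (w ;; proj1)) ;; r.
    rewrite /r /prod_assoc_inv.
    by repeat rewrite ?comp_pair ?compA ?pair_proj0 ?pair_proj1 ?comp1m.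
  rewrite !compA wE -!compA; congr (_ ;; _); apply: IHq => X' e' xy.
  have xyE : pair (total e') xy ;; r = pair (total
      ((map_elem (fun A => comp (xy ;; proj0) (C := A)) e, e') :
         elem (Hom X') (Prod p q))) (xy ;; proj1).
    rewrite /r /= total_precomp.
    by repeat rewrite ?comp_pair ?compA ?pair_proj0 ?pair_proj1.
  by rewrite !compA xyE.
Qed.

Lemma total_ext (A : D) (p : code A) (Z : D) (h k : Hom A Z) :
  (forall X (e : elem (Hom X) p), total e ;; h = total e ;; k) -> h = k.
Proof.
move=> hk; have E : proj0 (B := ⊤) ;; h = proj0 ;; k.
  by apply: (total_stable_ext (p := p)) => X e y; rewrite !compA pair_proj0.
rewrite -[h]comp1m -[k]comp1m -(pair_proj0 (idm A) to_terminal).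
by rewrite -!compA E.
Qed.

(** * Partial elements and their pairing *)

Definition kzero (X A : D) : Hom X (A + ⊤) := to_terminal ;; inj1.

Lemma comp_kzero (X Y A : D) (u : Hom X Y) : u ;; kzero Y A = kzero X A.
Proof. by rewrite /kzero compA (to_terminal_unique (_ ;; _)). Qed.

Lemma to_terminal_inj1 (X A : D) (u : Hom X ⊤) : u ;; inj1 = kzero X A.
Proof. by rewrite /kzero (to_terminal_unique u). Qed.

Lemma kcomp_kzero (X A B : D) (f : Hom A (B + ⊤)) : kcomp (kzero X A) f = kzero X B.
Proof. by rewrite kcompE -compA inj1_copair. Qed.

Lemma kzero_kcomp (X A B : D) (x : Hom X (A + ⊤)) : kcomp x (kzero A B) = kzero X B.
Proof.
rewrite kcompE -(comp_kzero B x); congr (_ ;; _).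
apply: copair_ext; rewrite ?inj0_copair ?inj1_copair comp_kzero //.
by rewrite -(to_terminal_inj1 _ (idm ⊤)) comp1m.
Qed.

(** [merge A B] is sealed because matching modulo unfolding would otherwise see
    the composite inside it when rewriting with associativity. *)
Fact merge_key : unit. Proof. exact: tt. Qed.

Definition merge (A B : D) : Hom ((A + ⊤) × (B + ⊤)) (A × B + ⊤) :=
  locked_with merge_key (exc_undist A B ;; (idm (A × B) +m to_terminal)).

Lemma inj00_merge (A B : D) : (inj0 ×m inj0) ;; merge A B = inj0.
Proof. by rewrite /merge unlock compA inj00_exc_undist inj0_summ comp1m. Qed.

Lemma inj01_merge (A B : D) : (inj0 ×m inj1) ;; merge A B = kzero _ _.
Proof.
by rewrite /merge unlock compA inj01_exc_undist -compA inj1_summ compA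
  to_terminal_inj1.
Qed.

Lemma inj1_merge (A B : D) : (inj1 ×m idm (B + ⊤)) ;; merge A B = kzero _ _.
Proof.
by rewrite /merge unlock compA inj1_exc_undist -compA inj1_summ compA
  to_terminal_inj1.
Qed.

Definition kpair (X A B : D) (x : Hom X (A + ⊤)) (y : Hom X (B + ⊤)) :
    Hom X (A × B + ⊤) :=
  pair x y ;; merge A B.

Lemma comp_kpair (X Y A B : D) (u : Hom X Y) (x : Hom Y (A + ⊤)) (y : Hom Y (B + ⊤)) :
  u ;; kpair x y = kpair (u ;; x) (u ;; y).
Proof. by rewrite /kpair compA comp_pair. Qed.

Lemma kpair_total (X A B : D) (x : Hom X A) (y : Hom X B) :
  kpair (x ;; inj0) (y ;; inj0) = pair x y ;; inj0.
Proof. by rewrite /kpair -pair_prodm -compA inj00_merge. Qed.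

Lemma kzero_kpair (X A B : D) (y : Hom X (B + ⊤)) : kpair (kzero X A) y = kzero X (A × B).
Proof.
by rewrite /kpair /kzero -[y in LHS]compm1 -pair_prodm -compA inj1_merge comp_kzero.
Qed.

Lemma kpair_kzero (X A B : D) (x : Hom X (A + ⊤)) : kpair x (kzero X B) = kzero X (A × B).
Proof.
have E : kpair (proj0 : Hom ((A + ⊤) × X) (A + ⊤)) (kzero _ B) = kzero _ (A × B).
{ apply: (total_ext (p := Prod (Sum (Var A) (Var ⊤)) (Var X))) => W [[a|u] w] /=;
    rewrite comp_kpair pair_proj0 !comp_kzero.
  - by rewrite /kpair /kzero -pair_prodm -compA inj01_merge comp_kzero.
  - by rewrite to_terminal_inj1 kzero_kpair. }
by rewrite -(comp_kzero (A × B) (pair x (idm X))) -E comp_kpair pair_proj0 comp_kzero.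
Qed.

Lemma kprodmE (A A' B B' : D) (f : Hom A (A' + ⊤)) (g : Hom B (B' + ⊤)) :
  kprodm f g = kpair (proj0 ;; f) (proj1 ;; g).
Proof. by rewrite /kpair /merge unlock compA. Qed.

Lemma kcomp_total (X A B : D) (x : Hom X A) (f : Hom A (B + ⊤)) : kcomp (x ;; inj0) f = x ;; f.
Proof. by rewrite kcompE -compA inj0_copair. Qed.

(** Operations on two partial elements that are natural in the domain agree if
    they agree on two total elements and whenever one argument is undefined: by
    naturality only the two projections of [(A + ⊤) × (B + ⊤)] matter, and
    distributivity splits that object. *)
Lemma kpair_ext (A B Z : D) (h k : forall X, Hom X (A + ⊤) -> Hom X (B + ⊤) -> Hom X Z) :
  (forall X Y (u : Hom X Y) x y, u ;; h Y x y = h X (u ;; x) (u ;; y)) ->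
  (forall X Y (u : Hom X Y) x y, u ;; k Y x y = k X (u ;; x) (u ;; y)) ->
  (forall X a b, h X (a ;; inj0) (b ;; inj0) = k X (a ;; inj0) (b ;; inj0)) ->
  (forall X y, h X (kzero X A) y = k X (kzero X A) y) ->
  (forall X x, h X x (kzero X B) = k X x (kzero X B)) ->
  forall X x y, h X x y = k X x y.
Proof.
move=> hN kN e e0 e1 X x y.
have E : h _ proj0 proj1 = k ((A + ⊤) × (B + ⊤)) proj0 proj1.
  apply: (total_ext (p := Prod (Sum (Var A) (Var ⊤)) (Sum (Var B) (Var ⊤)))).
  move=> W [[a|u] [b|v]] /=; rewrite hN kN pair_proj0 pair_proj1 //;
    by rewrite ?to_terminal_inj1 ?(to_terminal_inj1 A).
by rewrite -(pair_proj0 x y) -{2 4}(pair_proj1 x y) -hN -kN E.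
Qed.

Lemma kcomp_natural (X Y A B : D) (u : Hom X Y) (x : Hom Y (A + ⊤)) (f : Hom A (B + ⊤)) :
  u ;; kcomp x f = kcomp (u ;; x) f.
Proof. by rewrite !kcompE compA. Qed.

Lemma kpair_kprodm (X A A' B B' : D) (x : Hom X (A + ⊤)) (y : Hom X (B + ⊤))
    (f : Hom A (A' + ⊤)) (g : Hom B (B' + ⊤)) :
  kcomp (kpair x y) (kprodm f g) = kpair (kcomp x f) (kcomp y g).
Proof.
apply: (kpair_ext (h := fun X x y => kcomp (kpair x y) (kprodm f g))
                  (k := fun X x y => kpair (kcomp x f) (kcomp y g))).
- by move=> *; rewrite kcomp_natural comp_kpair.
- by move=> *; rewrite comp_kpair !kcomp_natural.
- move=> W a b; rewrite kpair_total !kcomp_total kprodmE comp_kpair !compA.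
  by rewrite pair_proj0 pair_proj1.
- by move=> W w; rewrite kzero_kpair !kcomp_kzero kzero_kpair.
- by move=> W w; rewrite kpair_kzero !kcomp_kzero kpair_kzero.
Qed.

Lemma kpair_swap (X A B : D) (x : Hom X (A + ⊤)) (y : Hom X (B + ⊤)) :
  kcomp (kpair x y) (J (prod_swap A B)) = kpair y x.
Proof.
apply: (kpair_ext (h := fun X x y => kcomp (kpair x y) (J (prod_swap A B)))
                  (k := fun X x y => kpair y x)).
- by move=> *; rewrite kcomp_natural comp_kpair.
- by move=> *; rewrite comp_kpair.
- move=> W a b; rewrite !kpair_total kcomp_total /J compA /prod_swap comp_pair.
  by rewrite pair_proj0 pair_proj1.
- by move=> W w; rewrite kzero_kpair !kcomp_kzero kpair_kzero.
- by move=> W w; rewrite kpair_kzero !kcomp_kzero kzero_kpair.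
Qed.

Lemma kpair_assoc (X A B C : D)
    (x : Hom X (A + ⊤)) (y : Hom X (B + ⊤)) (z : Hom X (C + ⊤)) :
  kcomp (kpair (kpair x y) z) (J (prod_assoc A B C)) = kpair x (kpair y z).
Proof.
pose (P := (A + ⊤) × (B + ⊤) × (C + ⊤)).
have E : kcomp (kpair (kpair (proj0 ;; proj0) (proj0 ;; proj1)) proj1)
           (J (prod_assoc A B C))
         = kpair (proj0 ;; proj0 : Hom P _) (kpair (proj0 ;; proj1) proj1).
  apply: (total_ext (p := Prod (Prod (Sum (Var A) (Var ⊤)) (Sum (Var B) (Var ⊤)))
                             (Sum (Var C) (Var ⊤)))).
  move=> W [[[a|u] [b|v]] [c|w]]; rewrite /= kcomp_natural !comp_kpair !compA;
    rewrite !(pair_proj0, pair_proj1) ?to_terminal_inj1;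
    rewrite ?to_terminal_inj1 !(kpair_total, kzero_kpair, kpair_kzero, kcomp_kzero) //.
  rewrite kcomp_total /J compA; congr (_ ;; _); rewrite /prod_assoc.
  by rewrite !comp_pair !compA !(pair_proj0, pair_proj1).
have := f_equal (comp (pair (pair x y) z)) E.
rewrite kcomp_natural !comp_kpair !compA !pair_proj0.
by rewrite !pair_proj1.
Qed.

(** * Realizers of Kleisli maps *)

Fixpoint partial (X A : D) (p : code A) : elem (fun A => Hom X (A + ⊤)) p -> Hom X (A + ⊤) :=
  match p in code A return elem (fun A => Hom X (A + ⊤)) p -> Hom X (A + ⊤) with
  | Var A => fun x => x
  | Zero => fun e => match e with end
  | Sum p q => fun e =>
      match e with
      | inl a => kcomp (partial a) (J inj0)
      | inr b => kcomp (partial b) (J inj1)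
      end
  | Prod p q => fun e => kpair (partial (fst e)) (partial (snd e))
  end.

Definition pelem (X A : D) (p : code A) : Type := elem (fun A => Hom X (A + ⊤)) p.

Definition result (X A : D) (p : code A) (r : option (pelem X p)) : Hom X (A + ⊤) :=
  match r with Some e => partial e | None => kzero X A end.

Definition action (A B : D) (p : code A) (q : code B) : Type :=
  forall X, pelem X p -> option (pelem X q).

Definition realizes (A B : D) (p : code A) (q : code B) (f : Hom A (B + ⊤))
    (φ : action p q) : Prop :=
  forall X (e : pelem X p), kcomp (partial e) f = result (φ X e).

Lemma partial_total (X A : D) (p : code A) (e : elem (Hom X) p) :
  partial (map_elem (fun A x => x ;; inj0) e) = total e ;; inj0.
Proof.
elim: p e => [A1||A1 B p IHp q IHq|A1 B p IHp q IHq] e //=.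
- by case: e => [a|b]; rewrite ?IHp ?IHq kcomp_total /J compA.
- by rewrite IHp IHq kpair_total.
Qed.

(** Only the total elements among the partial ones are used: they already are
    jointly epic. *)
Lemma realizes_ext (A B : D) (p : code A) (q : code B) (f g : Hom A (B + ⊤))
    (φ ψ : action p q) :
  realizes f φ -> realizes g ψ ->
  (forall X (e : pelem X p), φ X e = ψ X e) ->
  f = g.
Proof.
move=> fφ gψ φψ; apply: (total_ext (p := p)) => X e.
by rewrite -(kcomp_total _ f) -(kcomp_total _ g) -partial_total fφ gψ φψ.
Qed.

Lemma realizes_idm (A : D) (p : code A) :
  realizes (@exc_unit D A) (fun X (e : pelem X p) => Some e).
Proof. by move=> X e; rewrite kcompm1. Qed.

(** An arbitrary Kleisli map acts on atoms by composition.  Atoms must have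
    partial elements for this, since [f] need not be total. *)
Lemma realizes_var (A B : D) (f : Hom A (B + ⊤)) :
  realizes f (fun X (x : pelem X (Var A)) => Some (kcomp x f : pelem X (Var B))).
Proof. by []. Qed.

Definition comp_act (A B C : D) (p : code A) (q : code B) (r : code C)
    (φ : action p q) (ψ : action q r) : action p r := fun X e =>
  match φ X e with Some e' => ψ X e' | None => None end.

Lemma realizes_kcomp (A B C : D) (p : code A) (q : code B) (r : code C)
    (f : Hom A (B + ⊤)) (g : Hom B (C + ⊤)) (φ : action p q) (ψ : action q r) :
  realizes f φ -> realizes g ψ -> realizes (kcomp f g) (comp_act φ ψ).
Proof.
move=> fφ gψ X e; rewrite kcompA fφ /comp_act.
by case: (φ X e) => [e'|] /=; rewrite ?gψ ?kcomp_kzero.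
Qed.

Lemma realizes_inj0 (A B : D) (p : code A) (q : code B) :
  realizes (J inj0) (fun X (a : pelem X p) => Some (inl a : pelem X (Sum p q))).
Proof. by []. Qed.

Lemma realizes_inj1 (A B : D) (p : code A) (q : code B) :
  realizes (J inj1) (fun X (b : pelem X q) => Some (inr b : pelem X (Sum p q))).
Proof. by []. Qed.

Lemma kcompJJ (X A B C : D) (x : Hom X (A + ⊤)) (f : Hom A B) (g : Hom B (C + ⊤)) :
  kcomp (kcomp x (J f)) g = kcomp x (f ;; g).
Proof. by rewrite -kcompA /J kcomp_total. Qed.

Definition copair_act (A B C : D) (p : code A) (q : code B) (r : code C)
    (φ : action p r) (ψ : action q r) : action (Sum p q) r := fun X e =>
  match e with inl a => φ X a | inr b => ψ X b end.

Lemma realizes_copair (A B C : D) (p : code A) (q : code B) (r : code C)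
    (f : Hom A (C + ⊤)) (g : Hom B (C + ⊤)) (φ : action p r) (ψ : action q r) :
  realizes f φ -> realizes g ψ -> realizes (copair f g) (copair_act φ ψ).
Proof. by move=> fφ gψ X [a|b] /=; rewrite kcompJJ ?inj0_copair ?inj1_copair. Qed.

Lemma realizes_from_initial (A : D) (p : code A) (f : Hom ⊥ (A + ⊤)) :
  realizes f (fun X (e : pelem X Zero) =>
    match e return option (pelem X p) with end).
Proof. by move=> X []. Qed.

Definition prodm_act (A A' B B' : D) (p : code A) (p' : code A') (q : code B)
    (q' : code B') (φ : action p p') (ψ : action q q') :
    action (Prod p q) (Prod p' q') := fun X e =>
  match φ X (fst e), ψ X (snd e) with Some a', Some b' => Some (a', b') | _, _ => None end.

Lemma realizes_kprodm (A A' B B' : D) (p : code A) (p' : code A') (q : code B)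
    (q' : code B') (f : Hom A (A' + ⊤)) (g : Hom B (B' + ⊤))
    (φ : action p p') (ψ : action q q') :
  realizes f φ -> realizes g ψ -> realizes (kprodm f g) (prodm_act φ ψ).
Proof.
move=> fφ gψ X [a b] /=; rewrite kpair_kprodm fφ gψ /prodm_act /=.
by case: (φ X a) => [a'|]; case: (ψ X b) => [b'|] /=; rewrite ?kzero_kpair ?kpair_kzero.
Qed.

Lemma realizes_κ0 (A B : D) (p : code A) (q : code B) :
  realizes (J (κ0 A B)) (fun X (a : pelem X p) => Some (inl (inl a) : pelem X (Curly p q))).
Proof. by move=> X e /=; rewrite kcompJJ {1}/J !compA. Qed.

Lemma realizes_κ1 (A B : D) (p : code A) (q : code B) :
  realizes (J (κ1 A B)) (fun X (b : pelem X q) => Some (inl (inr b) : pelem X (Curly p q))).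
Proof. by move=> X e /=; rewrite kcompJJ {1}/J !compA. Qed.

Lemma kprodm_J (A A' B B' : D) (f : Hom A A') (g : Hom B B') :
  kprodm (J f) (J g) = J (f ×m g).
Proof. by rewrite kprodmE /J !compA kpair_total. Qed.

(** Total maps can be moved out of a pairing.  Together with [kcompJJ] and
    [comp_J] this brings the two sides of a realizer equation to the form of one
    total map applied to the same nested pairing. *)
Lemma kpair_kcompJl (X A A' B : D) (x : Hom X (A + ⊤)) (y : Hom X (B + ⊤)) (f : Hom A A') :
  kpair (kcomp x (J f)) y = kcomp (kpair x y) (J (f ×m idm B)).
Proof.
rewrite -kprodm_J kpair_kprodm; congr (kpair _ _).
by rewrite /J comp1m kcompm1.
Qed.

Lemma kpair_kcompJr (X A B B' : D) (x : Hom X (A + ⊤)) (y : Hom X (B + ⊤)) (g : Hom B B') :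
  kpair x (kcomp y (J g)) = kcomp (kpair x y) (J (idm A ×m g)).
Proof.
rewrite -kprodm_J kpair_kprodm; congr (kpair _ _).
by rewrite /J comp1m kcompm1.
Qed.

Lemma comp_J (A B C : D) (f : Hom A B) (g : Hom B C) : f ;; J g = J (f ;; g).
Proof. by rewrite /J compA. Qed.

(** * Realizers of the structure maps *)

Definition assoc_act (A B C : D) (p : code A) (q : code B) (r : code C) :
    action (Curly (Curly p q) r) (Curly p (Curly q r)) := fun X e =>
  match e with
  | inl (inl (inl (inl a))) => Some (inl (inl a))
  | inl (inl (inl (inr b))) => Some (inl (inr (inl (inl b))))
  | inl (inl (inr (a, b))) => Some (inr (a, inl (inl b)))
  | inl (inr c) => Some (inl (inr (inl (inr c))))
  | inr (inl (inl a), c) => Some (inr (a, inl (inr c)))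
  | inr (inl (inr b), c) => Some (inl (inr (inr (b, c))))
  | inr (inr (a, b), c) => Some (inr (a, inr (b, c)))
  end.

Lemma realizes_curly_assoc (A B C : D) (p : code A) (q : code B) (r : code C) :
  realizes (J (curly_assoc A B C)) (@assoc_act A B C p q r).
Proof.
have [a0 [a1 [a2 [a3 [a4 [a5 a6]]]]]] := curly_assocP A B C.
rewrite /κ0 /κ1 /κ2 ?compA in a0 a1 a2 a3 a4 a5 a6.
move=> X [[[[a|b]|[a b]]|c]|[[[a|b]|[a b]] c]] /=.
all: rewrite ?(kpair_kcompJl, kpair_kcompJr, kcompJJ, comp_J).
all: rewrite -?kpair_assoc ?(kcompJJ, comp_J).
all: congr (kcomp _ (J _)).
all: by rewrite !compA.
Qed.

Lemma inj0_undist_comp (A B C Z : D) (h : Hom ((A × B) + (A × C)) Z) :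
  (idm A ×m inj0) ;; (undist A B C ;; h) = inj0 ;; h.
Proof. by rewrite compA inj0_undist. Qed.

Lemma inj1_undist_comp (A B C Z : D) (h : Hom ((A × B) + (A × C)) Z) :
  (idm A ×m inj1) ;; (undist A B C ;; h) = inj1 ;; h.
Proof. by rewrite compA inj1_undist. Qed.

Lemma prod1m_comp (A B B' B'' : D) (f : Hom B B') (g : Hom B' B'') :
  idm A ×m (f ;; g) = (idm A ×m f) ;; (idm A ×m g).
Proof. by rewrite prodm_comp comp1m. Qed.

Lemma kpair_assoc_inv (X A B C : D)
    (x : Hom X (A + ⊤)) (y : Hom X (B + ⊤)) (z : Hom X (C + ⊤)) :
  kcomp (kpair x (kpair y z)) (J (prod_assoc_inv A B C)) = kpair (kpair x y) z.
Proof. by rewrite -kpair_assoc kcompJJ comp_J prod_assocK /J comp1m kcompm1. Qed.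

Definition assoc_inv_act (A B C : D) (p : code A) (q : code B) (r : code C) :
    action (Curly p (Curly q r)) (Curly (Curly p q) r) := fun X e =>
  match e with
  | inl (inl a) => Some (inl (inl (inl (inl a))))
  | inl (inr (inl (inl b))) => Some (inl (inl (inl (inr b))))
  | inl (inr (inl (inr c))) => Some (inl (inr c))
  | inl (inr (inr (b, c))) => Some (inr (inl (inr b), c))
  | inr (a, inl (inl b)) => Some (inl (inl (inr (a, b))))
  | inr (a, inl (inr c)) => Some (inr (inl (inl a), c))
  | inr (a, inr (b, c)) => Some (inr (inr (a, b), c))
  end.

Lemma realizes_curly_assoc_inv (A B C : D) (p : code A) (q : code B) (r : code C) :
  realizes (J (curly_assoc_inv A B C)) (@assoc_inv_act A B C p q r).
Proof.
move=> X [[a|[[b|c]|[b c]]]|[a [[b|c]|[b c]]]] /=.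
all: rewrite ?(kpair_kcompJl, kpair_kcompJr, kcompJJ, comp_J).
all: rewrite -?kpair_assoc_inv ?(kcompJJ, comp_J).
all: congr (kcomp _ (J _)).
all: rewrite /curly_assoc_inv ?prod1m_comp -!compA.
all: by rewrite ?(inj0_copair, inj1_copair, inj0_undist_comp, inj1_undist_comp) -?compA.
Qed.

Definition curly_swap_act (A B : D) (p : code A) (q : code B) :
    action (Curly p q) (Curly q p) := fun X e =>
  match e with
  | inl (inl a) => Some (inl (inr a))
  | inl (inr b) => Some (inl (inl b))
  | inr (a, b) => Some (inr (b, a))
  end.

Lemma realizes_curly_symmetry (A B : D) (p : code A) (q : code B) :
  realizes (curly_symmetry A B) (@curly_swap_act A B p q).
Proof.
move=> X [[a|b]|[a b]] /=; last rewrite -(kpair_swap (partial a)).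
all: rewrite !(kcompJJ, comp_J); congr (kcomp _ (J _)).
all: rewrite /curly_symm ?inj0_summ ?inj1_summ //.
all: by rewrite -compA inj0_summ compA /sum_swap ?inj0_copair ?inj1_copair.
Qed.

Lemma realizes_curly_runit_inv (A : D) (p : code A) :
  realizes (J (curly_runit_inv A)) (fun X (e : pelem X (Curly p Zero)) =>
    match e return option (pelem X p) with
    | inl (inl a) => Some a
    | inl (inr e') | inr (_, e') => match e' with end
    end).
Proof.
move=> X [[a|[]]|[? []]] /=.
by rewrite !(kcompJJ, comp_J) -compA !inj0_copair /J comp1m kcompm1.
Qed.

Lemma realizes_curly_lunit_inv (A : D) (p : code A) :
  realizes (J (curly_lunit_inv A)) (fun X (e : pelem X (Curly Zero p)) =>
    match e return option (pelem X p) with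
    | inl (inr a) => Some a
    | inl (inl e') | inr (e', _) => match e' with end
    end).
Proof.
move=> X [[[]|a]|[[] ?]] /=.
by rewrite !(kcompJJ, comp_J) -compA inj0_copair inj1_copair /J comp1m kcompm1.
Qed.

Definition δL_act (A B C : D) (p : code A) (q : code B) (r : code C) :
    action (Curly p (Sum q r)) (Sum (Curly p q) r) := fun X e =>
  match e with
  | inl (inl a) => Some (inl (inl (inl a)))
  | inl (inr (inl b)) => Some (inl (inl (inr b)))
  | inl (inr (inr c)) => Some (inr c)
  | inr (a, inl b) => Some (inl (inr (a, b)))
  | inr (a, inr c) => None
  end.

Lemma realizes_δL (A B C : D) (p : code A) (q : code B) (r : code C) :
  realizes (curly_plus_δL A B C) (@δL_act A B C p q r).
Proof.
move=> X [[a|[b|c]]|[a [b|c]]] /=.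
all: rewrite ?kpair_kcompJr !(kcompJJ, comp_J).
1-3: by rewrite /curly_plus_δL -?compA ?(inj0_copair, inj1_copair) /J ?compA.
- congr (kcomp _ _); rewrite /curly_plus_δL -!compA inj1_copair inj0_undist_comp.
  by rewrite (compA inj0) inj0_summ comp1m (compA inj0) inj0_summ -compA inj0_summ /J compA.
- rewrite -(kzero_kcomp _ (kpair (partial a) (partial c))); congr (kcomp _ _).
  rewrite /curly_plus_δL -!compA inj1_copair inj1_undist_comp.
  rewrite (compA inj1) inj1_summ -compA (compA inj1) inj1_summ comp1m inj1_summ comp1m.
  by rewrite to_terminal_inj1.
Qed.

(** In a symmetric linearly distributive category the left distributor
    determines the right one, by this formula. *)
Definition curly_plus_δR (A B C : D) : Hom (curly (A + B) C) (A + curly B C + ⊤) :=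
  kcomp (kcomp (kcomp (kcomp
    (curly_symmetry (A + B) C)
    (kcurlym (exc_unit C) (plus_symmetry A B)))
    (curly_plus_δL C B A))
    (ksumm (curly_symmetry C B) (exc_unit A)))
    (plus_symmetry (curly B C) A).

End Elements.

(** * Coherence by computation on elements *)

Ltac code_of A :=
  lazymatch A with
  | curly ?A ?B => let p := code_of A in let q := code_of B in constr:(Curly p q)
  | sumo ?A ?B => let p := code_of A in let q := code_of B in constr:(Sum p q)
  | @initial (dcat ?D) _ => constr:(@Zero D)
  | _ => constr:(Var A)
  end.

(** Finds a realizer by following the syntax of the map.  The functors are
    unfolded along the way: [kcurlym] and [ksumm] are made of [copair], [kprodm]
    and injections.  [realizes_var] comes last because it applies to any map
    between atoms, in particular to identities and composites. *)
Ltac realize :=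
  solve [repeat first
    [ eapply realizes_kcomp
    | eapply realizes_δL
    | eapply realizes_curly_assoc
    | eapply realizes_curly_assoc_inv
    | eapply realizes_curly_symmetry
    | eapply realizes_curly_runit_inv
    | eapply realizes_curly_lunit_inv
    | eapply realizes_κ0
    | eapply realizes_κ1
    | eapply realizes_kprodm
    | eapply realizes_idm
    | eapply realizes_inj0
    | eapply realizes_inj1
    | eapply realizes_copair
    | eapply realizes_from_initial
    | eapply realizes_var ]].

Ltac split_elem :=
  repeat match goal with
  | e : Empty_set |- _ => destruct e
  | e : sum _ _ |- _ => destruct e
  | e : prod _ _ |- _ => destruct e
  end.

Ltac coherence :=
  lazymatch goal with |- @eq (@Hom _ ?A ?B) _ _ =>
    let A := eval cbn in A in
    let B := eval cbn in B in
    let p := code_of A in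
    let q := code_of B in
    eapply (@realizes_ext _ _ _ p q); [realize | realize | ];
    let X := fresh "X" in let e := fresh "e" in
    move=> X e; cbn in e; split_elem; reflexivity
  end.

Section Laws.
Variable D : distributive_category.

Lemma curly_monoidal : is_monoidal (curly_data D).
Proof. by split=> *; try split; coherence. Qed.

Lemma plus_monoidal : is_monoidal (plus_data D).
Proof. by split=> *; try split; coherence. Qed.

Lemma curly_symmetric : is_symmetry (M := curly_data D) (@curly_symmetry D).
Proof. by split=> *; coherence. Qed.

Lemma plus_symmetric : is_symmetry (M := plus_data D) (@plus_symmetry D).
Proof. by split=> *; coherence. Qed.

Lemma curly_plus_LDC :
  is_LDC (T := curly_data D) (P := plus_data D) (@curly_plus_δR D) (@curly_plus_δL D).
Proof.
split; [exact: curly_monoidal | exact: plus_monoidal | ..].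
all: by move=> *; coherence.
Qed.

Lemma curly_plus_isomix :
  is_isomix (T := curly_data D) (P := plus_data D)
    (@curly_plus_δR D) (@curly_plus_δL D).
Proof.
exists (@exc_unit D ⊥); split; last by move=> A B; coherence.
by exists (@exc_unit D ⊥); split; coherence.
Qed.

End Laws.

Theorem proposition6p2 (D : distributive_category) :
  exists δR : right_distributor (curly_data D) (plus_data D),
    is_symmetric_LDC (T := curly_data D) (P := plus_data D)
      (@curly_symmetry D) (@plus_symmetry D) δR (@curly_plus_δL D) /\
    is_isomix (T := curly_data D) (P := plus_data D) δR (@curly_plus_δL D).
Proof.
exists (@curly_plus_δR D); split; last exact: curly_plus_isomix.
split=> //; first exact: curly_plus_LDC.
- exact: curly_symmetric.
- exact: plus_symmetric.
Qed.
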